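(* Let $n\ge 1$, let $\alpha\in\mathbb{Z}_{\ge 0}^n$ be a composition, let $t$ be a positive integer and let $r$ be a row index with $t+1\le r\le n$. Then the map $\Phi_{r,t}$ is an involution on $\mathrm{SSF}(\alpha)$, i.e. $\Phi_{r,t}$ maps $\mathrm{SSF}(\alpha)$ to itself and $\Phi_{r,t}(\Phi_{r,t}(F))=F$ for every $F\in \mathrm{SSF}(\alpha)$. In particular, $\Phi_{r,t}$ exchanges the numbers of free entries $t$ and $t+1$ in row $r$: for every $F\in\mathrm{SSF}(\alpha)$, the number of free entries $t$ (respectively, $t+1$) in row $r$ of $\Phi_{r,t}(F)$ equals the number of free entries $t+1$ (respectively, $t$) in row $r$ of $F$.
   Context: **Skyline fillings.** For a composition $\alpha=(\alpha_1,\dots,\alpha_n)\in\mathbb{Z}_{\ge0}^n$, the skyline diagram $D(\alpha)$ is the left-justified array with $\alpha_i$ boxes in row $i$; row indices increase from top to bottom, column indices from left to right, and $(i,j)$ is the box in row $i$, column $j$. A skyline filling $F$ for $\alpha$ assigns a positive integer $F(i,j)$ to each box $(i,j)\in D(\alpha)$. It is semistandard if: (i) entries weakly decrease from left to right in each row; (ii) $F(i,j)\le i$ for every box (flag condition); (iii) entries in each column are distinct; (iv) if $(i,j),(i',j)\in D(\alpha)$ with $i'>i$ and $F(i',j)<F(i,j)$, then $(i,j+1)\in D(\alpha)$ and $F(i',j)<F(i,j+1)$. $\mathrm{SSF}(\alpha)$ is the set of semistandard skyline fillings for $\alpha$. **Classification of entries $t$, $t+1$.** Let $F\in\mathrm{SSF}(\alpha)$.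 An entry $t$ (resp. $t+1$) is paired if its column also contains $t+1$ (resp. $t$); otherwise it is unpaired. An unpaired $t$ and an unpaired $t+1$ are pseudo-free (associated with each other) if (1) the $t+1$ lies to the upper right of the $t$ (in a row strictly above and a column strictly to the right), and (2) every column strictly between the columns of these two entries contains both $t$ and $t+1$. An entry $t$ or $t+1$ is free if it is neither paired nor pseudo-free. **Lowering operator $L_{r,t}$.** If row $r$ of $F$ has no free entry $t+1$, set $L_{r,t}(F)=F$. Otherwise let the rightmost free entry $t+1$ in row $r$ be in column $j$. Let $j'<j$ be the smallest column index such that for every $k$ with $j'\le k<j$, $F(r,k)=t+1$ and column $k$ contains an entry $t$ below row $r$. $L_{r,t}(F)$ is obtained from $F$ by replacing the $t+1$ in box $(r,j)$ by $t$ and exchanging the entries $t$ and $t+1$ in each column $k$ with $j'\le k<j$; if no such $j'$ exists, only the $t+1$ in box $(r,j)$ is replaced by $t$. **Raising operator $R_{r,t}$** (for $r\ge t+1$). If row $r$ of $F$ has no free entry $t$, set $R_{r,t}(F)=F$. Otherwise let the leftmost free entry $t$ in row $r$ be in column $j$. Let $j'<j$ be the smallest column index such that for every $k$ with $j'\le k<j$, $F(r,k)=t$ and column $k$ contains an entry $t+1$ below row $r$. $R_{r,t}(F)$ is obtained from $F$ by replacing the $t$ in box $(r,j)$ by $t+1$ and exchanging the entries $t$ and $t+1$ in each column $k$ with $j'\le k<j$; if no such $j'$ exists, only the $t$ in box $(r,j)$ is replaced by $t+1$. **The map $\Phi_{r,t}$** (for $r\ge t+1$). For $F\in\mathrm{SSF}(\alpha)$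 let $n_1$ (resp. $n_2$) be the number of free entries $t+1$ (resp. $t$) in row $r$ of $F$. Set $\Phi_{r,t}(F)=F$ if $n_1=n_2$; $\Phi_{r,t}(F)=L_{r,t}^{\,n_1-n_2}(F)$ if $n_1>n_2$; $\Phi_{r,t}(F)=R_{r,t}^{\,n_2-n_1}(F)$ if $n_1<n_2$. *)

(* Defs.v *)
From mathcomp Require Import all_boot.
Set Implicit Arguments.
Unset Strict Implicit.
Unset Printing Implicit Defensive.

(* Rows and columns are indexed from 0: the row [i : 'I_n] is the row [i.+1] of
   the usual convention, so the flag condition reads [F u <= (row u).+1].
   Row indices increase from top to bottom. *)

Section Skyline.

Variables (n : nat) (alpha : 'I_n -> nat).

Definition box : finType := {i : 'I_n & 'I_(alpha i)}.

Definition mkbox (i : 'I_n) (j : 'I_(alpha i)) : box :=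
  Tagged (fun i => 'I_(alpha i)) j.

Definition row (u : box) : 'I_n := tag u.

Definition col (u : box) : nat := tagged u.

(* Positivity of the entries is part of [semistandard]. *)
Definition filling := {ffun box -> nat}.

Implicit Types (F : filling) (u v w : box).

Definition positive_entries F := [forall u, 0 < F u].

Definition rows_weakly_decreasing F :=
  [forall u, forall v, (row u == row v) && (col u <= col v) ==> (F v <= F u)].

Definition flagged F := [forall u, F u <= (row u).+1].

Definition columns_distinct F :=
  [forall u, forall v, (col u == col v) && (u != v) ==> (F u != F v)].

Definition column_inversion_condition F :=
  [forall u, forall v,
    [&& col u == col v, row u < row v & F v < F u] ==>
    [exists w, [&& row w == row u, col w == (col u).+1 & F v < F w]]].

Definition semistandard F :=
  [&& positive_entries F, rows_weakly_decreasing F, flagged F,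
      columns_distinct F & column_inversion_condition F].

Definition SSF : {pred filling} := [pred F | semistandard F].

Definition in_column F (k x : nat) := [exists u, (col u == k) && (F u == x)].

(* [paired] is only meaningful on boxes whose entry is [t] or [t.+1]. *)
Definition paired F (t : nat) u :=
  ((F u == t) && in_column F (col u) t.+1)
  || ((F u == t.+1) && in_column F (col u) t).

(* [u] holds the [t], and [v] the [t.+1] to its upper right. *)
Definition pseudo_free_pair F (t : nat) u v :=
  [&& F u == t, F v == t.+1, ~~ paired F t u, ~~ paired F t v,
      row v < row u, col u < col v &
      [forall k : 'I_(col v),
         (col u < k) ==> (in_column F k t && in_column F k t.+1)]].

Definition pseudo_free F (t : nat) u :=
  [exists v, pseudo_free_pair F t u v || pseudo_free_pair F t v u].

Definition free F (t : nat) u :=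
  [&& (F u == t) || (F u == t.+1), ~~ paired F t u & ~~ pseudo_free F t u].

(* For [x = t] or [x = t.+1]: the columns of the free entries [x] in row [r]. *)
Definition free_in_row F (r : 'I_n) (t x : nat) : {set 'I_(alpha r)} :=
  [set j | (F (mkbox j) == x) && free F t (mkbox j)].

Definition rightmost m (A : {set 'I_m}) : option 'I_m :=
  [pick j in A | [forall k in A, k <= j]].

Definition leftmost m (A : {set 'I_m}) : option 'I_m :=
  [pick j in A | [forall k in A, j <= k]].

Definition exchangeable F (r : 'I_n) (x y : nat) (k : 'I_(alpha r)) :=
  (F (mkbox k) == x) && [exists u, [&& col u == k :> nat, r < row u & F u == y]].

(* The smallest [j' < j] such that all columns [k] with [j' <= k < j] are
   exchangeable, and [j] when there is none: [find] returns the size of its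
   list argument when its search fails. *)
Definition exchange_start F (r : 'I_n) (x y : nat) (j : 'I_(alpha r)) : nat :=
  find (fun j' => [forall k : 'I_(alpha r),
                     (j' <= k < j) ==> exchangeable F x y k])
       (iota 0 j).

Definition exchange (x y z : nat) :=
  if z == x then y else if z == y then x else z.

Definition replace_entry F (r : 'I_n) (x y : nat) (j : 'I_(alpha r)) : filling :=
  [ffun u => if u == mkbox j then y
             else if exchange_start F x y j <= col u < j then exchange x y (F u)
             else F u].

Definition lowering (r : 'I_n) (t : nat) F : filling :=
  if rightmost (free_in_row F r t t.+1) is Some j
  then replace_entry F t.+1 t j else F.

Definition raising (r : 'I_n) (t : nat) F : filling :=
  if leftmost (free_in_row F r t t) is Some j
  then replace_entry F t t.+1 j else F.

Definition Phi (r : 'I_n) (t : nat) F : filling :=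
  let n1 := #|free_in_row F r t t.+1| in
  let n2 := #|free_in_row F r t t| in
  if n1 == n2 then F
  else if n2 < n1 then iter (n1 - n2) (lowering r t) F
  else iter (n2 - n1) (raising r t) F.

End Skyline.

Arguments SSF {n} alpha.

(* Main.v *)
(* Only the entries [t] and [t.+1] matter.  In a semistandard filling the row of
   a given entry weakly moves down along consecutive columns containing it.
   This shows that when [L] acts in row [r] at column [j], starting the exchanges
   at column [s], the next entry of row [r] is at most [t] and column [s - 1] has
   no [t] below row [r]; the result is then semistandard.  The columns
   containing both [t] and [t.+1] do not change, and the box [(r, j)] becomes a
   free [t], which is the leftmost one of row [r], while the other free entries
   of row [r] stay the same.  The exchanges of [R] therefore start again at
   [s], so [R] undoes [L].  The argument for [R] is dual, and the involution
   follows since [L] (resp. [R]) moves the numbers of free [t.+1] and [t] by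
   [(-1, +1)] (resp. [(+1, -1)]). *)
Require Import Defs.
From mathcomp Require Import all_boot zify.
Set Implicit Arguments.
Unset Strict Implicit.
Unset Printing Implicit Defensive.

(** * Fillings as total functions of a row and a column *)

Section Grid.

Variables (n : nat) (alpha : 'I_n -> nat).
Implicit Types (F : filling alpha) (u v : box alpha).

(** Totality avoids the dependent type of boxes, so that neighbouring entries can be compared by
    plain arithmetic. *)
Definition grid F (i k : nat) : nat :=
  if insub i is Some i' then
    if insub k is Some j then F (@mkbox n alpha i' j) else 0
  else 0.

Lemma box_eq u v : row u = row v :> nat -> col u = col v -> u = v.
Proof.
case: u v => [i j] [i' j']; rewrite /row /col /= => /ord_inj eq_i.
by case: _ / eq_i j' => j' /ord_inj ->.
Qed.

Lemma box_at (i : 'I_n) k : k < alpha i -> exists2 u : box alpha, row u = i & col u = k.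
Proof. by move=> lt_k; exists (mkbox (Ordinal lt_k)). Qed.

Lemma gridE F u : grid F (row u) (col u) = F u.
Proof. by case: u => i j; rewrite /grid /row /col /= !valK. Qed.

Lemma grid_mkbox F (i : 'I_n) (j : 'I_(alpha i)) : grid F i j = F (mkbox j).
Proof. exact: (gridE F (mkbox j)). Qed.

(** The equations quantify over [F], so one case analysis evaluates a filling and its modification
    at the same position. *)
Variant grid_spec i k : Prop :=
| GridBox (u : box alpha) of row u = i :> nat & col u = k & (forall F, grid F i k = F u)
| GridOut of (forall u : box alpha, row u = i :> nat -> col u <> k)
           & (forall F, grid F i k = 0).

Lemma gridP i k : grid_spec i k.
Proof.
have [lt_i | le_i] := ltnP i n; last first.
  right=> [[i' j] /= ei|F]; first by have := ltn_ord i'; rewrite /row /= in ei; lia.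
  by rewrite /grid insubN // -leqNgt.
have [lt_k | le_k] := ltnP k (alpha (Ordinal lt_i)).
  by left with (mkbox (Ordinal lt_k)) => // F; rewrite -gridE.
right=> [[i' j] /= ei|F].
  have ei' : Ordinal lt_i = i' by apply: ord_inj; exact: esym ei.
  case: _ / ei' j {ei} => j; rewrite /col /=; have := ltn_ord j; lia.
by rewrite /grid insubT /= insubN // -leqNgt.
Qed.

Lemma filling_eq F F' : (forall i k, grid F i k = grid F' i k) -> F = F'.
Proof. by move=> eqG; apply/ffunP=> u; rewrite -!gridE. Qed.

Lemma grid_gt0 F i k : 0 < grid F i k ->
  exists u : box alpha, [/\ row u = i :> nat, col u = k & F u = grid F i k].
Proof. by case: (gridP i k) => [u ? ? -> _|_ ->] //; exists u. Qed.

(** Bounds the width of the diagram uniformly in the row; an entry that propagates forever along a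
    row is refuted by it. *)
Lemma grid_large F i k : \max_(i' < n) alpha i' <= k -> grid F i k = 0.
Proof.
case: (gridP i k) => [u _ <- _ |_ -> //]; case: u => i' j; rewrite /col /= => le_j.
by have := leq_trans (ltn_ord j) (leq_bigmax i' (F := alpha)); rewrite ltnNge le_j.
Qed.

Lemma in_columnP F k x : 0 < x ->
  reflect (exists i, grid F i k = x) (in_column F k x).
Proof.
move=> x_gt0; apply: (iffP existsP) => [[u /andP[/eqP <- /eqP <-]]|[i def_x]].
  by exists (row u); rewrite gridE.
have [|u [_ cu Fu]] := @grid_gt0 F i k; first by rewrite def_x.
by exists u; rewrite cu Fu def_x !eqxx.
Qed.

(* The value [0] stands for the absence of a box, so [grid_dec] also says that
   rows are left-justified, and [grid_inv] that box [(i, k.+1)] exists. *)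
Record semistandard_grid (G : nat -> nat -> nat) : Prop := SemistandardGrid {
  grid_dec : forall i k, G i k.+1 <= G i k;
  grid_flag : forall i k, G i k <= i.+1;
  grid_inj : forall i i' k, 0 < G i k -> G i k = G i' k -> i = i';
  grid_inv : forall i i' k,
    i < i' -> 0 < G i' k -> G i' k < G i k -> G i' k < G i k.+1
}.

Lemma grid_row_anti G i k k' : semistandard_grid G -> k <= k' -> G i k' <= G i k.
Proof.
move=> sG /subnKC <-; elim: (k' - k) => [|d IHd]; first by rewrite addn0.
by rewrite addnS (leq_trans (grid_dec sG _ _)).
Qed.

(** Positivity is kept apart because [grid F] cannot tell an entry [0] from a missing box. *)
Lemma semistandardP F :
  reflect ((forall u, 0 < F u) /\ semistandard_grid (grid F)) (semistandard F).
Proof.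
apply: (iffP and5P) => [[/forallP pos dec flag dist inv]|[pos sG]].
  split=> //; split=> [i k|i k|i i' k|i i' k].
  - case: (gridP i k.+1) => [u ri ck ->|_ -> //].
    case: (gridP i k) => [v ri' ck' ->|no _].
      by move/forallP/(_ v)/forallP/(_ u)/implyP: dec; apply; rewrite -val_eqE /= ri ri' ck ck'; lia.
    have [|v rv cv] := @box_at (row u) k.
      by case: (u) ck => i' j; rewrite /row /col /=; have := ltn_ord j; lia.
    by case: (no v) => //; rewrite rv.
  - case: (gridP i k) => [u <- _ ->|_ -> //]; exact: (forallP flag).
  - case: (gridP i k) => [u <- cu ->|_ -> //].
    case: (gridP i' k) => [v <- cv -> _ eF|_ -> ]; last by lia.
    have [-> // | neq] := eqVneq u v.
    move/forallP/(_ u)/forallP/(_ v)/implyP: dist.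
    by rewrite cu cv eqxx neq eF eqxx => /(_ isT).
  - case: (gridP i' k) => [v rv cv -> |_ -> //].
    case: (gridP i k) => [u ru cu -> lt_i _ ltF|_ ->]; last by lia.
    move/forallP/(_ u)/forallP/(_ v)/implyP: inv; rewrite cu cv eqxx ru rv lt_i ltF.
    case/(_ isT)/existsP=> w /and3P[/eqP rw /eqP cw].
    by rewrite -ru -rw -cw gridE.
split.
- exact/forallP.
- apply/forallP=> u; apply/forallP=> v; apply/implyP=> /andP[/eqP ruv le_c].
  by rewrite -!gridE ruv grid_row_anti.
- by apply/forallP=> u; rewrite -gridE (grid_flag sG).
- apply/forallP=> u; apply/forallP=> v; apply/implyP=> /andP[/eqP cuv].
  apply: contraNneq; rewrite -!gridE cuv => eF.
  by apply/eqP/box_eq=> //; apply: (grid_inj sG) eF; rewrite -cuv gridE.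
- apply/forallP=> u; apply/forallP=> v; apply/implyP=> /and3P[/eqP cuv ltr ltF].
  have := @grid_inv _ sG (row u) (row v) (col v) ltr.
  rewrite gridE -{1}cuv gridE => /(_ (pos v) ltF) ltF'.
  have [|w [rw cw Fw]] := @grid_gt0 F (row u) (col v).+1; first by lia.
  by apply/existsP; exists w; rewrite cw Fw cuv ltF' -val_eqE /= rw !eqxx.
Qed.


(** * Paired columns and free entries *)

Definition both F t k := in_column F k t && in_column F k t.+1.

Lemma bothP F t k : 0 < t ->
  reflect ((exists i, grid F i k = t) /\ (exists i, grid F i k = t.+1))
          (both F t k).
Proof.
move=> t0; apply: (iffP andP) => [[/(in_columnP _ _ t0) a /in_columnP b]|[a b]].
  by split; [|apply: b].
by split; apply/in_columnP.
Qed.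

(** The box itself supplies one of the two entries, so being paired is a property of the column
    alone. *)
Lemma paired_both F t u :
  (F u == t) || (F u == t.+1) -> paired F t u = both F t (col u).
Proof.
have in_col : in_column F (col u) (F u) by apply/existsP; exists u; rewrite !eqxx.
rewrite /paired /both => /orP[] /eqP Fu; rewrite Fu in in_col *; rewrite in_col eqxx.
  by rewrite (ltn_eqF (ltnSn t)) orbF.
by rewrite (gtn_eqF (ltnSn t)) /= andbT.
Qed.

Lemma pseudo_free_pairP F t u v : 0 < t ->
  reflect [/\ F u = t, F v = t.+1, ~~ both F t (col u) /\ ~~ both F t (col v),
             row v < row u /\ col u < col v
           & forall k, col u < k < col v -> both F t k]
          (pseudo_free_pair F t u v).
Proof.
move=> t0; apply: (iffP and5P) => [[/eqP Fu /eqP Fv]|[Fu Fv]].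
  rewrite !paired_both ?Fu ?Fv ?eqxx ?orbT // => nu nv /and3P[ltr ltc /forallP bt].
  split=> // k /andP[lt1 lt2].
  by have /implyP/(_ lt1) := bt (Ordinal lt2).
rewrite !paired_both ?Fu ?Fv ?eqxx ?orbT // => -[-> ->] [-> ->] bt.
split=> //; apply/forallP=> k; apply/implyP=> lt_k.
by apply: bt; rewrite lt_k ltn_ord.
Qed.

(** Not being pseudo-free is put positively: every unpaired [t.+1] to the upper right is separated
    from the [t] by an unpaired column. *)
Definition free_low F t r j := [/\ grid F r j = t, ~~ both F t j
  & forall i m, i < r -> j < m -> grid F i m = t.+1 -> ~~ both F t m ->
      exists2 l, j < l < m & ~~ both F t l].

Definition free_high F t r j := [/\ grid F r j = t.+1, ~~ both F t j
  & forall i k, r < i -> k < j -> grid F i k = t -> ~~ both F t k ->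
      exists2 l, k < l < j & ~~ both F t l].

Lemma not_both_between F t a b :
  ~ (forall k, a < k < b -> both F t k) -> exists2 l, a < l < b & ~~ both F t l.
Proof.
move=> nb; have [/hasP[k]|/hasPn all_b] :=
  boolP (has (fun k => (a < k) && ~~ both F t k) (iota 0 b)).
  by rewrite mem_iota add0n /= => lt_k /andP[lt_a nk]; exists k; rewrite ?lt_a.
case: nb => k /andP[lt_a lt_b]; have := all_b k.
by rewrite mem_iota add0n lt_b lt_a negbK; apply.
Qed.

Lemma free_lowP F t (r : 'I_n) (j : 'I_(alpha r)) : 0 < t ->
  reflect (free_low F t r j) (j \in free_in_row F r t t).
Proof.
move=> t0; rewrite inE /free; set u := mkbox j; rewrite /free_low grid_mkbox -/u.
have [/= Fu|neF] := eqVneq (F u) t; last by right=> -[/eqP]; rewrite (negPf neF).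
rewrite paired_both ?Fu ?eqxx //.
have [bj|nu] /= := boolP (both F t j); first by right=> -[].
apply: (iffP idP) => [/existsPn npf|[_ _ fr]].
  split=> // i m lti ltm Gim nm; apply: not_both_between => bt.
  have [|v [rv cv Fv]] := @grid_gt0 F i m; first by rewrite Gim.
  have /norP[/negP[]] := npf v; apply/pseudo_free_pairP => //.
  by rewrite cv rv Fv.
apply/existsPn=> v; apply/norP; split; apply/pseudo_free_pairP => // -[].
  move=> _ Fv [_ nv] [ltr ltc] bt.
  have [||||l ltl] := fr (row v) (col v) => //; first by rewrite gridE.
  by rewrite bt.
by rewrite Fu; lia.
Qed.

Lemma free_highP F t (r : 'I_n) (j : 'I_(alpha r)) : 0 < t ->
  reflect (free_high F t r j) (j \in free_in_row F r t t.+1).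
Proof.
move=> t0; rewrite inE /free; set u := mkbox j; rewrite /free_high grid_mkbox -/u.
have [/= Fu|neF] := eqVneq (F u) t.+1; last by right=> -[/eqP]; rewrite (negPf neF).
rewrite orbT paired_both ?Fu ?eqxx ?orbT //.
have [bj|nu] /= := boolP (both F t j); first by right=> -[].
apply: (iffP idP) => [/existsPn npf|[_ _ fr]].
  split=> // i k lti ltk Gik nk; apply: not_both_between => bt.
  have [|v [rv cv Fv]] := @grid_gt0 F i k; first by rewrite Gik.
  have /norP[_ /negP[]] := npf v; apply/pseudo_free_pairP => //.
  by rewrite cv rv Fv.
apply/existsPn=> v; apply/norP; split; apply/pseudo_free_pairP => // -[].
  by rewrite Fu; lia.
move=> Fv _ [nv _] [ltr ltc] bt.
have [||||l ltl] := fr (row v) (col v) => //; first by rewrite gridE.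
by rewrite bt.
Qed.

(** If [x] moved up from row [q] to row [p'] in the next column, row [p'] would exceed [x] in the
    first of these columns, and the inversion condition would make it exceed [x] in the second as
    well. *)
Lemma entry_row_mono G x p l p' m : semistandard_grid G -> 0 < x ->
  G p l = x -> G p' m = x -> l <= m ->
  (forall k, l < k < m -> exists i, G i k = x) -> p <= p'.
Proof.
move=> sG x0 Gpl; elim: m p' => [|m IHm] p' Gp'm; rewrite leq_eqVlt => /predU1P[elm|ltm] ex.
- by rewrite (@grid_inj _ sG p p' l) ?Gpl // elm Gp'm.
- by [].
- by rewrite (@grid_inj _ sG p p' l) ?Gpl // elm Gp'm.
have [q Gqm le_pq] : exists2 q, G q m = x & p <= q.
  move: ltm; rewrite ltnS leq_eqVlt => /predU1P[<-|ltm]; first by exists p.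
  have [|q Gqm] := ex m; first by rewrite ltm /=.
  by exists q => //; apply: IHm => // [|k]; [exact: ltnW | move=> ?; apply: ex; lia].
apply: leq_trans le_pq _; rewrite leqNgt; apply/negP => lt_p'q.
have := grid_dec sG p' m; have := @grid_inj _ sG p' q m; have := @grid_inv _ sG p' q m.
lia.
Qed.

(** * The exchanged columns and the change of entries in them *)

Definition exchangeable_at F r x y k :=
  grid F r k = x /\ exists2 i, r < i & grid F i k = y.

Lemma exchangeableP F (r : 'I_n) x y (k : 'I_(alpha r)) : 0 < y ->
  reflect (exchangeable_at F r x y k) (exchangeable F x y k).
Proof.
move=> y0; rewrite /exchangeable_at grid_mkbox; apply: (iffP andP).
  case=> /eqP Fk /existsP[u /and3P[/eqP cu ltr /eqP Fu]]; split=> //.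
  by exists (row u); rewrite -?cu ?gridE.
case=> Fk [i ltr Gi]; split; first exact/eqP.
have [|u [ru cu Fu]] := @grid_gt0 F i k; first by rewrite Gi.
by apply/existsP; exists u; rewrite cu ru ltr Fu Gi !eqxx.
Qed.

(** The admissible starts are closed upwards, so the smallest is the only one whose left neighbour
    is not exchangeable. This local criterion allows the starts found in two different fillings to
    be compared. *)
Lemma exchange_startP F (r : 'I_n) x y (j : 'I_(alpha r)) s : 0 < y ->
  s = exchange_start F x y j <->
  [/\ s <= j, forall k, s <= k < j -> exchangeable_at F r x y k
    & forall k, k.+1 = s -> ~ exchangeable_at F r x y k].
Proof.
move=> y0; rewrite /exchange_start; set a := fun _ => _.
have aP s' : reflect (forall k, s' <= k < j -> exchangeable_at F r x y k) (a s').
  apply: (iffP forallP) => [ex k /andP[le_k lt_k]|ex k]; last first.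
    by apply/implyP=> /ex /exchangeableP; apply.
  have lt_k' := ltn_trans lt_k (ltn_ord j).
  by have /implyP := ex (Ordinal lt_k'); rewrite le_k lt_k => /(_ isT)/exchangeableP; apply.
have step k : k < j -> exchangeable_at F r x y k -> a k.+1 -> a k.
  move=> ltk exk /aP ex; apply/aP=> k' /andP[]; rewrite leq_eqVlt => /predU1P[<- //|].
  by move=> lt lt'; apply: ex; rewrite lt.
set f := find _ _.
have le_f : f <= j by rewrite -[X in _ <= X](size_iota 0) find_size.
have af : a f.
  have [hs|] := boolP (has a (iota 0 j)).
    by have := nth_find 0 hs; rewrite nth_iota ?add0n // -[X in _ < X](size_iota 0) -has_find.
  rewrite has_find size_iota -leqNgt -/f => le_j.
  by apply/aP=> k; lia.
have nf k : k < f -> ~~ a k.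
  move=> ltk; have := before_find 0 ltk; rewrite nth_iota ?add0n => [->//|].
  exact: leq_trans ltk le_f.
split=> [->|[les ex nex]].
  split=> //; first exact/aP.
  by move=> k ek exk; have := nf k; rewrite step ?ek //; lia.
apply/eqP; rewrite eqn_leq; apply/andP; split.
  rewrite leqNgt; apply/negP=> ltfs; case: s ltfs les ex nex => // s ltfs les ex nex.
  apply: (nex s) => //; move/aP: af; apply; lia.
by rewrite leqNgt; apply/negP=> /nf /negP[]; apply/aP.
Qed.

(** One relation for both operators, which differ by swapping [x] and [y]. Column [j] belongs to the
    first range but not to the second: it has no [y] to send back to [x]. *)
Definition flips (G G' : nat -> nat -> nat) r x y s j := forall i k,
  [\/ [/\ i = r, s <= k <= j, G i k = x & G' i k = y],
      [/\ r < i, s <= k < j, G i k = y & G' i k = x]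
    | G' i k = G i k /\ (s <= k <= j -> i <> r /\ G i k <> x /\ G i k <> y)].

Lemma grid_replace F (r : 'I_n) x y (j : 'I_(alpha r)) i k : 0 < x -> 0 < y ->
  grid (replace_entry F x y j) i k =
    if (i == r) && (k == j) then y
    else if exchange_start F x y j <= k < j then exchange x y (grid F i k)
    else grid F i k.
Proof.
move=> x0 y0; case: (gridP i k) => [u ru cu gu|no g0]; last first.
  rewrite !g0; case: ifPn => [/andP[/eqP ei /eqP ek]|_].
    by case: (no (mkbox j)).
  by rewrite /exchange !(ltn_eqF x0, ltn_eqF y0) if_same.
rewrite !gu ffunE cu; congr (if _ then _ else _).
rewrite -ru -cu; apply/eqP/andP => [->|[/eqP er /eqP ek]]; first by rewrite !eqxx.
exact: box_eq.
Qed.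

(** Since column entries are distinct, the only [x] of an exchanged column is the one in row [r],
    and its only [y] is the one below. *)
Lemma replace_flips F (r : 'I_n) x y (j : 'I_(alpha r)) :
  semistandard_grid (grid F) -> 0 < x -> 0 < y -> x != y ->
  grid F r j = x -> (forall i, grid F i j <> y) ->
  flips (grid F) (grid (replace_entry F x y j)) r x y (exchange_start F x y j) j.
Proof.
move=> sG x0 y0 neq Gj ny i k; rewrite grid_replace //.
have [les ex _] := (exchange_startP F x j (exchange_start F x y j) y0).1 erefl.
move: (exchange_start F x y j) les ex => s les ex.
have [/andP[/eqP -> /eqP ->]|ne] := boolP ((i == r) && (k == j)).
  by apply: Or31; split=> //; lia.
have [/[dup] ltk /ex[Gk [q ltq Gq]]|nk] := boolP (s <= k < j); last first.
  apply: Or33; split=> // lek; have ek : k = j by lia.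
  subst k; split=> [ei|]; first by rewrite ei !eqxx in ne.
  split=> // Gi; move: ne.
  by rewrite (@grid_inj _ sG i r j) ?eqxx //; lia.
rewrite /exchange; have [Gi|nx] := eqVneq (grid F i k) x.
  by apply: Or31; split=> //; [apply: (@grid_inj _ sG i r k)|]; lia.
have [Gi|ny'] := eqVneq (grid F i k) y; last first.
  by apply: Or33; split=> // _; split=> [ei|]; [rewrite ei in nx|]; lia.
by apply: Or32; split=> //; rewrite (@grid_inj _ sG i q k) //; lia.
Qed.

End Grid.

Lemma flips_outside G G' r x y s j i k :
  flips G G' r x y s j -> ~~ (s <= k <= j) -> G' i k = G i k.
Proof. by move=> fl nk; case: (fl i k) => [[_ lek]|[_ lek]|[]] //; lia. Qed.

Lemma flips_gt0 G G' r x y s j i k : 0 < x -> 0 < y ->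
  flips G G' r x y s j -> (0 < G' i k) = (0 < G i k).
Proof. by move=> x0 y0 fl; case: (fl i k) => [[_ _ -> ->]|[_ _ -> ->]|[-> _]] //; lia. Qed.

(** Before column [j] two values of a column are swapped; in column [j] the new value [y] was
    absent. *)
Lemma flips_inj G G' r x y s j : 0 < x -> 0 < y ->
  (forall k, s <= k < j -> exists i, G i k = y) -> (forall i, G i j <> y) ->
  (forall i i' k, 0 < G i k -> G i k = G i' k -> i = i') ->
  flips G G' r x y s j ->
  forall i i' k, 0 < G' i k -> G' i k = G' i' k -> i = i'.
Proof.
move=> x0 y0 ex ny inj fl i i' k; rewrite (flips_gt0 i k x0 y0 fl).
have [ltk|nk] := boolP (s <= k < j).
  have [q Gq] := ex k ltk.
  have := inj i i' k; have := inj i q k; have := inj i' q k.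
  by case: (fl i k) => [] [] *; case: (fl i' k) => [] [] *; lia.
have := inj i i' k; case: (fl i k) => [] []; case: (fl i' k) => [] [] *; lia.
Qed.

(** * Invariants of a single move, in either direction *)

Section Move.

Variables (n : nat) (alpha : 'I_n -> nat) (F F' : filling alpha) (t r s j : nat).
Hypotheses (t0 : 0 < t) (sG : semistandard_grid (grid F)) (les : s <= j).

Local Notation G := (grid F).
Local Notation G' := (grid F').

(** A swap keeps the set of entries of a column, and column [j] holds exactly one of [t] and [t.+1]
    before and after the move. *)
Lemma move_both x y k :
  (x == t) && (y == t.+1) || (x == t.+1) && (y == t) -> 
  (forall k, s <= k < j -> exchangeable_at F r x y k) ->
  ~~ both F t j -> G r j = x ->
  flips G G' r x y s j ->
  both F' t k = both F t k.
Proof.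
move=> xy ex nj Gj fl.
have [lek|nk] := boolP (s <= k <= j); last first.
  apply/bothP/bothP => // -[[i Gi] [i' Gi']].
    by split; [exists i|exists i']; rewrite -(flips_outside _ fl).
  by split; [exists i|exists i']; rewrite (flips_outside _ fl).
have [ltk|gek] := ltnP k j.
  have [|Gk [q ltq Gq]] := ex k; first by lia.
  have Gk' : G' r k = y.
    by case: (fl r k) => [[]|[]|[_ /(_ lek)]]; lia.
  have Gq' : G' q k = x.
    by case: (fl q k) => [[]|[]|[_ /(_ lek)]]; lia.
  apply/bothP/bothP => // _.
    by case/orP: xy => /andP[/eqP <- /eqP <-]; split; [exists r|exists q|exists q|exists r].
  by case/orP: xy => /andP[/eqP <- /eqP <-]; split; [exists q|exists r|exists r|exists q].
have -> : k = j by lia.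
rewrite (negPf nj); apply/negP => /bothP[] // [i Gi] [i' Gi'].
have nG' i1 : G' i1 j <> x.
  by case: (fl i1 j) => [[]|[]|[]]; lia.
by case/orP: xy => /andP[/eqP ex' /eqP ey]; [apply: (nG' i)|apply: (nG' i')]; lia.
Qed.

(** If column [m.+1] were unpaired, its [t.+1] would be free, since the unpaired column [j]
    separates it from every [t] further left. If its [t] were above row [r], that row would exceed
    [t.+1] in column [m], and the inversion condition against row [r] would forbid a [t] next to
    it. *)
Lemma lower_next m : ~~ both F t j -> G r j = t.+1 -> j <= m ->
  (forall k, j < k <= m -> both F t k) ->
  G r m = t.+1 -> (forall i, G i m = t -> r < i) ->
  (forall k, j < k -> ~ free_high F t r k) ->
  G r m.+1 = t.+1 -> exists2 i, r < i & G i m.+1 = t.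
Proof.
move=> nj Gj lejm bt Gm bel nf Gm1.
have [/bothP[] // [i Gi] _|nm] := boolP (both F t m.+1); last first.
  case: (nf m.+1); first by lia.
  split=> // i k ltr ltk Gik nk; exists j => //.
  have [//|le_jk|ejk] := ltngtP k j; first by rewrite bt ?le_jk // in nk.
  case/negP: nj; apply/bothP => //; split; last by exists r.
  by exists i; rewrite -ejk.
exists i => //; rewrite ltnNge; apply/negP => lei.
have [eir|nir] := eqVneq i r; first by rewrite eir in Gi; lia.
have := bel i; have := grid_dec sG i m.
have := @grid_inv _ sG i r m; have := @grid_inj _ sG i r m.
lia.
Qed.

(** Apart from pairedness, freeness of a [t] looks only at its own column and those to the right;
    freeness of a [t.+1] looks only to the left. *)
Lemma move_free_low k : (forall m, both F' t m = both F t m) ->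
  (forall i m, k <= m -> G' i m = G i m) ->
  free_low F' t r k <-> free_low F t r k.
Proof.
move=> eqb eqG; rewrite /free_low eqG // eqb.
split=> -[Gk nk fr]; split=> // i m lti ltm Gm.
  move=> nm; have [||||l ltl] := fr i m; rewrite ?eqb ?eqG //; try lia.
  by exists l.
rewrite eqb => nm; rewrite eqG in Gm; last by lia.
by have [l ltl nl] := fr i m lti ltm Gm nm; exists l; rewrite ?eqb.
Qed.

Lemma move_free_high k : (forall m, both F' t m = both F t m) ->
  (forall i m, m <= k -> G' i m = G i m) ->
  free_high F' t r k <-> free_high F t r k.
Proof.
move=> eqb eqG; rewrite /free_high eqG // eqb.
split=> -[Gk nk fr]; split=> // i m lti ltm Gm.
  move=> nm; have [||||l ltl] := fr i m; rewrite ?eqb ?eqG //; try lia.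
  by exists l.
rewrite eqb => nm; rewrite eqG in Gm; last by lia.
by have [l ltl nl] := fr i m lti ltm Gm nm; exists l; rewrite ?eqb.
Qed.

(** * One lowering move *)

Section Lower.

Hypotheses (fj : free_high F t r j)
  (maxj : forall k, j < k -> ~ free_high F t r k)
  (ex : forall k, s <= k < j -> exchangeable_at F r t.+1 t k)
  (nex : forall k, k.+1 = s -> ~ exchangeable_at F r t.+1 t k)
  (fl : flips G G' r t.+1 t s j).

(* Otherwise [t.+1] would propagate along row [r] beyond the end of the diagram. *)
Lemma lower_row_end : G r j.+1 <= t.
Proof.
have [Gj nj _] := fj; rewrite leqNgt; apply/negP => gtG.
have Gj1 : G r j.+1 = t.+1 by have := grid_dec sG r j; lia.
suff inf d : [/\ G r (j + d).+1 = t.+1, exists2 i, r < i & G i (j + d).+1 = t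
               & forall k, j < k <= (j + d).+1 -> both F t k].
  have [Gm _ _] := inf (\max_(i < n) alpha i).
  by move: Gm; rewrite grid_large //; lia.
have bt m : G r m = t.+1 -> (exists2 i, r < i & G i m = t) -> both F t m.
  by move=> Gm [i _ Gi]; apply/bothP => //; split; [exists i|exists r].
have ntj i : G i j <> t.
  by move=> Gi; case/negP: nj; apply/bothP => //; split; [exists i|exists r].
elim: d => [|d [Gm [q ltq Gq] btm]].
  rewrite addn0; have nxt : exists2 i, r < i & G i j.+1 = t.
    by apply: (lower_next nj) => // [k|i]; [lia|move=> /ntj].
  split=> // k lek; have -> : k = j.+1 by lia.
  exact: bt.
(* The [t] below row [r] forces, by the inversion condition, an entry larger than [t] in the next
   box of row [r]. *)
rewrite addnS; have Gm2 : G r (j + d).+2 = t.+1.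
  by have := grid_dec sG r (j + d).+1; have := @grid_inv _ sG r q (j + d).+1 ltq; lia.
have nxt : exists2 i, r < i & G i (j + d).+2 = t.
  apply: (lower_next nj) => // [|i Gi]; first by lia.
  by rewrite (@grid_inj _ sG i q (j + d).+1) //; lia.
split=> // k lek; have [le|gt] := leqP k (j + d).+1; first by apply: btm; lia.
have -> : k = (j + d).+2 by lia.
exact: bt.
Qed.

(** Given such a [t], minimality of [s] makes row [r] exceed [t.+1] in column [k]. If the column is
    unpaired, the [t] is pseudo-free with the [t.+1] of column [j]. If it is paired, the inversion
    condition yields in column [s] either a second [t.+1] or an entry of row [r] above [t.+1]. *)
Lemma lower_left i k : k.+1 = s -> r < i -> G i k <> t.
Proof.
move=> es ltr Gi; have [Gj nj free_rj] := fj.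
have Gs : G r s = t.+1.
  by move: les; rewrite leq_eqVlt => /predU1P[->|lt] //; have [|-> _] := ex (k := s); rewrite ?leqnn.
have lt_k : t.+1 < G r k.
  have : G r k <> t.+1 by move=> Gk; apply: (nex es); split=> //; exists i.
  by have := grid_dec sG r k; rewrite es; lia.
have [/bothP[] // _ [q Gq]|nk] := boolP (both F t k); last first.
  have ltk : k < j by lia.
  have [l ltl /negP[]] := free_rj i k ltr ltk Gi nk.
  have [|Gl [q _ Gq]] := ex (k := l); first by lia.
  by apply/bothP => //; split; [exists q|exists r].
have := @grid_inv _ sG q i k; have := @grid_inv _ sG r q k.
have := grid_dec sG q k; have := @grid_inj _ sG q r s; rewrite es.
have qr : q <> r by move=> eqr; rewrite eqr in Gq; lia.
lia.
Qed.

Lemma lower_both k : both F' t k = both F t k.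
Proof.
by have [Gj nj _] := fj; apply: (@move_both t.+1 t k _ ex nj Gj fl); rewrite !eqxx orbT.
Qed.

Lemma lower_outside k : (k < s) || (j < k) -> forall i, G' i k = G i k.
Proof. by move=> nk i; apply: (flips_outside _ fl); lia. Qed.

Lemma lower_row k : s <= k <= j -> G r k = t.+1 /\ G' r k = t.
Proof. by move=> lek; case: (fl r k) => [[]|[]|[]]; lia. Qed.

Lemma lower_inside_both k : s <= k < j -> both F t k.
Proof.
move=> /ex[Gk [q _ Gq]]; by apply/bothP => //; split; [exists q|exists r].
Qed.

(** Nothing to the left of [s] changes; in columns [s] to [j] row [r] now holds [t], and beyond [j]
    it is at most [t]. *)
Lemma lower_free_high k :
  free_high F' t r k <-> free_high F t r k /\ k <> j.
Proof.
have right_le m : j < m -> G r m <= t.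
  by move=> ltm; apply: leq_trans lower_row_end; apply: grid_row_anti.
have [ltk|gek] := ltnP k s.
  rewrite move_free_high; [split=> [|[]] //; split=> //; lia| exact: lower_both|].
  by move=> i m lem; apply: lower_outside; lia.
split=> [[Gk nk _]|[[Gk nk _] ne]].
  have [lek|gtk] := leqP k j; first by have := @lower_row k; lia.
  by have := right_le k gtk; rewrite lower_outside ?gtk ?orbT // in Gk; lia.
have [lek|gtk] := leqP k j; last by have := right_le k gtk; lia.
by case/negP: nk; apply: lower_inside_both; lia.
Qed.

Lemma lower_free_low k :
  free_low F' t r k <-> free_low F t r k \/ k = j.
Proof.
have [Gj nj _] := fj; have [ltk|gek] := ltnP j k.
  rewrite move_free_low; [split=> [|[]] //; [by left|lia]| exact: lower_both|].
  by move=> i m lem; apply: lower_outside; lia.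
split=> [[Gk nk _]|[[Gk nk _]|->]].
- right; have [ltk|gek'] := ltnP k s.
    have := grid_row_anti r sG (leq_trans (ltnW ltk) les).
    by rewrite lower_outside ?ltk // in Gk; lia.
  rewrite lower_both in nk; apply/eqP; apply: contraR nk => nek.
  by apply: lower_inside_both; lia.
- have := grid_row_anti r sG gek; lia.
split; [by apply: (lower_row _).2; lia|by rewrite lower_both|].
move=> i m lti ltm; rewrite lower_outside ?ltm ?orbT // => Gi nm.
apply: not_both_between => bt.
(* In the old filling box [(r, j)] holds [t.+1], so the [t.+1] of row [i] further right cannot be
   higher up. *)
suff : r <= i by lia.
apply: (@entry_row_mono G t.+1 r j i m) => // [|l /bt]; first exact: ltnW.
by rewrite lower_both => /bothP[].
Qed.

(** Only the two ends of the run endanger the row condition: [lower_row_end] settles column [j], and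
    [lower_left] settles the entries raised below row [r] in column [s]. *)
Lemma lower_semistandard : t <= r.+1 -> semistandard_grid G'.
Proof.
move=> ler; have [Gj nj _] := fj.
have ntj i : G i j <> t.
  by move=> Gi; case/negP: nj; apply/bothP => //; split; [exists i|exists r].
split=> [i k|i k|i i' k|i i' k].
- have := grid_dec sG i k; have := grid_dec sG r k; have := @lower_left i k.
  have : i = r -> k = j -> G i k.+1 <= t by move=> -> ->; exact: lower_row_end.
  by case: (fl i k) => [] []; case: (fl i k.+1) => [] [] *; lia.
- by have := grid_flag sG i k; case: (fl i k) => [] []; lia.
- apply: (flips_inj _ _ _ _ _ fl) => // [k' /ex[_ [q _ Gq]]|]; first by exists q.
  exact: (grid_inj sG).
move=> lti; have low i1 k1 : G i1 k1 <= G' i1 k1 \/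
    [/\ i1 = r, s <= k1 <= j, G i1 k1 = t.+1 & G' i1 k1 = t].
  by case: (fl i1 k1) => [|[_ _ -> ->]|[-> _]]; [right|left|left].
have up : i <> r -> G i k.+1 <= G' i k.+1 by move=> nr; case: (low i k.+1) => [//|[]].
have inv := grid_inv sG lti (k := k).
case: (fl i' k) => [[ei' lek Gi' ->]|[lti' ltk Gi' ->]|[-> c]] pos.
- subst i'; case: (fl i k) => [[? _ _ ->]|[? _ _ ->]|[-> /(_ lek)[nr [n1 n2]]]]; [lia|lia|].
  by move=> gtG; have := up nr; lia.
- have lek : s <= k <= j by lia.
  case: (fl i k) => [[_ _ _ ->]|[_ _ _ ->]|[-> /(_ lek)[nr [n1 n2]] gtG]]; [lia|lia|].
  (* Above row [r] the inversion condition is applied against the [t.+1] of row [r]; below it, the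
     next entry exceeds [t] and cannot be the [t.+1] that row [r] already holds in that column. *)
  have [Gr _] := lower_row lek; have [|Gr1 _] := lower_row (k := k.+1); first by lia.
  have := up nr; have [lir|ler'] := ltnP i r.
    by have := grid_inv sG lir (k := k); lia.
  by have := grid_inj sG (i := i) (i' := r) (k := k.+1); lia.
have := up; case: (fl i k) => [[ei lek Gi ->]|[ltr ltk Gi ->]|[-> c']] up' ltG.
- have := low i k.+1; have : G i' k < t by lia.
  by move=> ? [|[]]; lia.
- by lia.
case: (low i k.+1) => [|[ei lek Gi Gi1]]; first by lia.
(* Here [i = r] and [k.+1 = s]: the entry needed above [G i' k] has dropped to [t], so [G i' k] must
   not be [t]. *)
have := lower_left (i := i') (k := k); lia.
Qed.

Lemma lower_exchangeable_back k : s <= k < j -> exchangeable_at F' r t t.+1 k.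
Proof.
move=> ltk; have [Gk [q ltq Gq]] := ex ltk; split; first by apply: (lower_row _).2; lia.
by exists q => //; case: (fl q k) => [[]|[]|[]]; lia.
Qed.

Lemma lower_not_exchangeable_back k : k.+1 = s -> ~ exchangeable_at F' r t t.+1 k.
Proof.
move=> es [Gk _]; have [|Gs _] := lower_row (k := s); first by lia.
by have := grid_dec sG r k; rewrite lower_outside in Gk; rewrite ?es; lia.
Qed.

End Lower.

(** * One raising move *)

Section Raise.

Hypotheses (fj : free_low F t r j)
  (minj : forall k, k < j -> ~ free_low F t r k)
  (ex : forall k, s <= k < j -> exchangeable_at F r t t.+1 k)
  (nex : forall k, k.+1 = s -> ~ exchangeable_at F r t t.+1 k)
  (fl : flips G G' r t t.+1 s j).

Lemma raise_no_succ i : G i j <> t.+1.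
Proof.
have [Gj nj _] := fj.
by move=> Gi; case/negP: nj; apply/bothP => //; split; [exists r|exists i].
Qed.

Lemma raise_inside_both k : s <= k < j -> both F t k.
Proof.
by move=> /ex[Gk [q _ Gq]]; apply/bothP => //; split; [exists r|exists q].
Qed.

Lemma raise_row k : s <= k <= j -> G r k = t /\ G' r k = t.+1.
Proof. by move=> lek; case: (fl r k) => [[]|[]|[]]; lia. Qed.

Lemma raise_outside k : (k < s) || (j < k) -> forall i, G' i k = G i k.
Proof. by move=> nk i; apply: (flips_outside _ fl); lia. Qed.

Lemma raise_both k : both F' t k = both F t k.
Proof.
by have [Gj nj _] := fj; apply: (@move_both t t.+1 k _ ex nj Gj fl); rewrite !eqxx.
Qed.

Lemma raise_upper_succ i k : i < r -> s <= k <= j -> G i k <> t.+1.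
Proof.
move=> lti lek Gi; have [ltk|gek] := ltnP k j; last first.
  have ekj : k = j by lia.
  by rewrite ekj in Gi; case: (raise_no_succ Gi).
have [|Gk [q ltq Gq]] := ex (k := k); first by lia.
have := grid_inj sG (i := i) (i' := q) (k := k); lia.
Qed.

(** A [t] there would be free if unpaired, against the choice of [j]. If paired, its [t.+1] is not
    below row [r] by minimality of [s]; if above, the inversion condition would push it into column
    [s], where the [t.+1] is not above row [r]. *)
Lemma raise_row_start k : k.+1 = s -> t < G r k.
Proof.
move=> es; have [Gj nj _] := fj; have [|Gs _] := raise_row (k := s); first by lia.
have : G r k <> t; last by have := grid_dec sG r k; rewrite es; lia.
move=> Gk; have ltkj : k < j by lia.
have [/bothP[] // _ [q Gq]|nk] := boolP (both F t k); last first.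
  case: (minj ltkj); split=> // i m lti ltm Gi nm.
  apply: not_both_between => bt; have [ltjm|ltmj|ejm] := ltngtP j m.
  - by case/negP: nj; apply: bt; lia.
  - by case/negP: nm; apply: raise_inside_both; lia.
  by subst m; case: (raise_no_succ Gi).
have [ltqr|lerq] := ltnP q r; last first.
  apply: (nex es); split=> //; exists q => //.
  by rewrite ltn_neqAle lerq andbT; apply/eqP=> erq; rewrite erq in Gk; lia.
have := grid_inv sG ltqr (k := k); have := grid_dec sG q k.
have := raise_upper_succ (i := q) (k := s) ltqr; rewrite es; lia.
Qed.

(** Column [s] has its [t] in row [r], and the row of [t] weakly moves down. *)
Lemma raise_left i k : k.+1 = s -> r < i -> G i k <> t.
Proof.
move=> es ltr Gi; have [|Gs _] := raise_row (k := s); first by lia.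
suff : i <= r by lia.
apply: (@entry_row_mono G t i k r s) => // [|l]; lia.
Qed.

(* Otherwise [t.+1] would propagate along row [i] beyond the end of the diagram. *)
Lemma raise_right i : i < r -> G i j.+1 <> t.+1.
Proof.
move=> lti Gi; have [Gj nj free_rj] := fj.
suff inf d : G i (j + d).+1 = t.+1 /\ forall k, j < k <= j + d -> both F t k.
  by have [] := inf (\max_(i < n) alpha i); rewrite grid_large //; lia.
elim: d => [|d [Gm btm]]; first by rewrite addn0; split=> // k; lia.
rewrite addnS; have btm1 : both F t (j + d).+1.
  have ltj : j < (j + d).+1 by lia.
  apply: contraT => nm; have [l ltl /negP[]] := free_rj i _ lti ltj Gm nm.
  by apply: btm; lia.
have bt k : j < k <= (j + d).+1 -> both F t k.
  by move=> lek; have [->//|ne] := eqVneq k (j + d).+1; apply: btm; lia.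
split=> //; have [q Gq] : exists q, G q (j + d).+1 = t by have /bothP[] := btm1.
(* The [t] starts in row [r] of column [j] and only moves down, so it stays below row [i] and forces
   the next entry of row [i] above [t]. *)
have leq : r <= q.
  apply: (@entry_row_mono G t r j q (j + d).+1) => // [|k ltk]; first by lia.
  by have /bothP[] : both F t k by apply: bt; lia.
have := grid_inv sG (i := i) (i' := q) (k := (j + d).+1).
have := grid_dec sG i (j + d).+1; lia.
Qed.

Lemma raise_free_low k :
  free_low F' t r k <-> free_low F t r k /\ k <> j.
Proof.
have [ltk|gek] := ltnP j k.
  rewrite move_free_low; [split=> [|[]] //; split=> //; lia| exact: raise_both|].
  by move=> i m lem; apply: raise_outside; lia.
split=> [[Gk _ _]|[frk ne]]; last by case: (minj _ frk); lia.
have [les_k|ltks] := leqP s k; first by have [] := @raise_row k; lia.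
case: (posnP s) => [s0|/prednK es]; first by lia.
have := raise_row_start es; have := @grid_row_anti _ r k s.-1 sG.
by rewrite raise_outside ?ltks // in Gk; lia.
Qed.

Lemma raise_free_high k :
  free_high F' t r k <-> free_high F t r k \/ k = j.
Proof.
have [Gj nj _] := fj; have [ltk|gek] := ltnP k s.
  rewrite move_free_high; [split=> [|[]] //; [by left|lia]| exact: raise_both|].
  by move=> i m lem; apply: raise_outside; lia.
split=> [[Gk nk _]|[[Gk nk _]|->]].
- right; have [ltjk|lekj] := ltnP j k.
    have := grid_row_anti r sG (ltnW ltjk).
    by rewrite raise_outside ?ltjk ?orbT // in Gk; lia.
  rewrite raise_both in nk; apply/eqP; apply: contraR nk => nek.
  by apply: raise_inside_both; lia.
- have := grid_row_anti r sG gek; have [] := @raise_row s; lia.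
split; [by apply: (raise_row _).2; lia|by rewrite raise_both|].
move=> i m lti ltm; have [lem|gtm] := leqP s m.
  by rewrite raise_both raise_inside_both //; lia.
rewrite raise_outside ?gtm // => Gi nm.
apply: not_both_between => bt.
suff : i <= r by lia.
apply: (@entry_row_mono G t i m r j) => // [|l /bt]; first exact: ltnW.
by rewrite raise_both => /bothP[].
Qed.

(** The flag condition needs [t <= r] because row [r] receives [t.+1]. At the ends of the run,
    [raise_row_start] and [raise_no_succ] keep the rows decreasing. *)
Lemma raise_semistandard : t <= r -> semistandard_grid G'.
Proof.
move=> ler; have [Gj nj _] := fj.
split=> [i k|i k|i i' k|i i' k].
- have := grid_dec sG i k.
  have : i = r -> k.+1 = s -> t < G i k by move=> ->; exact: raise_row_start.
  have : k.+1 = j -> G i k.+1 <> t.+1 by move=> ->; apply: raise_no_succ.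
  by case: (fl i k) => [] []; case: (fl i k.+1) => [] [] *; lia.
- by have := grid_flag sG i k; case: (fl i k) => [] []; lia.
- apply: (flips_inj _ _ _ _ _ fl) => // [k' /ex[_ [q _ Gq]]||]; first by exists q.
    exact: raise_no_succ.
  exact: (grid_inj sG).
move=> lti; have low i1 k1 : G i1 k1 <= G' i1 k1 \/
    [/\ r < i1, s <= k1 < j, G i1 k1 = t.+1 & G' i1 k1 = t].
  by case: (fl i1 k1) => [[_ _ -> ->]||[-> _]]; [left|right|left].
have inv := grid_inv sG lti (k := k).
have lowk := low i k.+1.
case: (fl i' k) => [[ei' lek Gi' ->]|[lti' ltk Gi' ->]|[-> c]] pos.
- subst i'; case: (fl i k) => [[? _ _ ->]|[? _ _ ->]|[-> /(_ lek)[nr [n1 n2]]]]; [lia|lia|].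
  (* The old inversion only gives an entry above [t], while row [r] now holds [t.+1]. *)
  move=> gtG; have : G i k.+1 <> t.+1; last by case: lowk => [|[]]; lia.
  have [ltk|gek] := ltnP k j; first by apply: raise_upper_succ; lia.
  have -> : k = j by lia.
  exact: raise_right.
- have lek : s <= k <= j by lia.
  case: (fl i k) => [[ei _ _ ->]|[_ _ _ ->]|[-> /(_ lek)[nr [n1 n2]] gtG]]; [|lia|].
    by move=> _; subst i; have [] := raise_row (k := k.+1); lia.
  by case: lowk => [|[]]; lia.
case: (fl i k) => [[ei lek Gi ->]|[ltr ltk Gi ->]|[-> c']] ltG.
- subst i; have [ltk|gek] := ltnP k j; first by have [] := raise_row (k := k.+1); lia.
  have ek : k = j by lia.
  have := c lek; case: lowk => [|[]]; lia.
- by have : G i' k < t; case: lowk => [|[]]; lia.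
case: lowk => [|[ltri ltk Gi1 Gi1']]; first by lia.
have [lesk|ltks] := leqP s k; first by lia.
have := raise_left (i := i') (k := k); lia.
Qed.

Lemma raise_exchangeable_back k : s <= k < j -> exchangeable_at F' r t.+1 t k.
Proof.
move=> ltk; have [Gk [q ltq Gq]] := ex ltk; split; first by apply: (raise_row _).2; lia.
by exists q => //; case: (fl q k) => [[]|[]|[]]; lia.
Qed.

Lemma raise_not_exchangeable_back k : k.+1 = s -> ~ exchangeable_at F' r t.+1 t k.
Proof.
move=> es [_ [i ltr]]; rewrite raise_outside; last by lia.
exact: raise_left.
Qed.

End Raise.
End Move.

(** * Lowering and raising as mutually inverse steps *)

Section Steps.

Variables (n : nat) (alpha : 'I_n -> nat) (t : nat) (r : 'I_n).
Hypotheses (t0 : 0 < t) (le_tr : t <= r).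
Implicit Types F : filling alpha.

Lemma rightmostP m (A : {set 'I_m}) j :
  rightmost A = Some j <-> j \in A /\ forall k, k \in A -> k <= j.
Proof.
rewrite /rightmost; case: pickP => [i /andP[Ai /forallP maxi]|no].
  split=> [[<-]|[Aj maxj]]; first by split=> // k; apply/implyP.
  congr Some; apply/ord_inj/eqP; rewrite eqn_leq maxj //.
  by have /implyP -> := maxi j.
split=> // -[Aj maxj]; have /negP[] := no j; rewrite Aj.
by apply/forallP=> k; apply/implyP; apply: maxj.
Qed.

Lemma leftmostP m (A : {set 'I_m}) j :
  leftmost A = Some j <-> j \in A /\ forall k, k \in A -> j <= k.
Proof.
rewrite /leftmost; case: pickP => [i /andP[Ai /forallP mini]|no].
  split=> [[<-]|[Aj minj]]; first by split=> // k; apply/implyP.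
  congr Some; apply/ord_inj/eqP; rewrite eqn_leq minj // andbT.
  by have /implyP -> := mini j.
split=> // -[Aj minj]; have /negP[] := no j; rewrite Aj.
by apply/forallP=> k; apply/implyP; apply: minj.
Qed.

(** Exchanging twice restores the entries. The start is the one computed in [F'], so undoing a move
    reduces to showing that both searches agree. *)
Lemma flips_replace F F' x y (j : 'I_(alpha r)) :
  0 < x -> 0 < y -> x != y -> grid F r j = x ->
  flips (grid F) (grid F') r x y (exchange_start F' y x j) j ->
  replace_entry F' y x j = F.
Proof.
move=> x0 y0 neq Gj fl; apply: filling_eq => i k; rewrite grid_replace //.
have [/andP[/eqP -> /eqP ->] //|ne] := boolP ((i == r) && (k == j)).
rewrite /exchange; move: (fl i k); move: (exchange_start F' y x j) => s.
case: ifPn => lek [[ei ltk -> ->]|[_ ltk -> ->]|[-> c]]; rewrite ?eqxx //.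
- by rewrite (negPf neq).
- have lek' : s <= k <= j by lia.
  by have [_ [/eqP/negPf -> /eqP/negPf ->]] := c lek'.
- by case/negP: ne; apply/andP; split; apply/eqP=> //; lia.
Qed.

Lemma free_highE F (j : 'I_(alpha r)) :
  j \in free_in_row F r t t.+1 <-> free_high F t r j.
Proof. by split=> [|?]; [move/free_highP; apply | apply/free_highP]. Qed.

Lemma free_lowE F (j : 'I_(alpha r)) :
  j \in free_in_row F r t t <-> free_low F t r j.
Proof. by split=> [|?]; [move/free_lowP; apply | apply/free_lowP]. Qed.

Lemma grid_lt F k : 0 < grid F r k -> k < alpha r.
Proof.
move=> /grid_gt0[[i j] [/ord_inj ei <- _]]; rewrite /row /col /= in ei *.
by rewrite -ei ltn_ord.
Qed.

Lemma lowering_step F : semistandard F -> 0 < #|free_in_row F r t t.+1| ->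
  [/\ semistandard (lowering r t F),
      #|free_in_row F r t t.+1| = #|free_in_row (lowering r t F) r t t.+1|.+1,
      #|free_in_row (lowering r t F) r t t| = #|free_in_row F r t t|.+1
    & raising r t (lowering r t F) = F].
Proof.
move=> /semistandardP[pos sG] /card_gt0P[j0 Aj0].
have [j rj] : exists j, rightmost (free_in_row F r t t.+1) = Some j.
  case: (@arg_maxnP _ j0 (mem (free_in_row F r t t.+1)) (fun k => k : nat) Aj0) => j Aj maxj.
  by exists j; apply/rightmostP.
have -> : lowering r t F = replace_entry F t.+1 t j by rewrite /lowering rj.
move/rightmostP: rj => [Aj maxj]; set F' := replace_entry F t.+1 t j.
set s := exchange_start F t.+1 t j.
have [les ex nex] := (exchange_startP F t.+1 j s t0).1 erefl.
have fj := (free_highE F j).1 Aj; have [Gj nj _] := fj.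
have ntj i : grid F i j <> t.
  by move=> Gi; case/negP: nj; apply/bothP => //; split; [exists i|exists r].
have neq : t.+1 != t by lia.
have fl : flips (grid F) (grid F') r t.+1 t s j by apply: replace_flips.
have maxj' k : j < k -> ~ free_high F t r k.
  move=> ltk frk; have ltka : k < alpha r by apply: (@grid_lt F); case: frk => ->.
  by have := maxj (Ordinal ltka) ((free_highE F (Ordinal ltka)).2 frk); rewrite /=; lia.
have sG' := lower_semistandard t0 sG les fj maxj' ex nex fl (leqW le_tr).
have high := lower_free_high t0 sG les fj maxj' ex fl.
have low := lower_free_low t0 sG les fj ex fl.
have eqA : free_in_row F' r t t.+1 = free_in_row F r t t.+1 :\ j.
  apply/setP=> k; rewrite !in_setD1; apply/idP/andP => [/free_highE/high[frk ne]|[ne /free_highE frk]].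
    by split; [apply: contra_not_neq ne => -> | apply/free_highE].
  by apply/free_highE/high; split=> // /ord_inj ekj; rewrite ekj eqxx in ne.
have eqB : free_in_row F' r t t = j |: free_in_row F r t t.
  apply/setP=> k; apply/idP/setU1P => [/free_lowE/low[frk|/ord_inj]|[->|frk]].
  - by right; apply/free_lowE.
  - by left.
  - by apply/free_lowE/low; right.
  - by apply/free_lowE/low; left; apply/free_lowE.
split.
- apply/semistandardP; split=> // u.
  by rewrite -gridE (flips_gt0 _ _ _ _ fl) // gridE.
- by rewrite eqA (cardsD1 j (free_in_row F r t t.+1)) Aj.
- rewrite eqB cardsU1; case: (boolP (j \in _)) => // /free_lowE[Gj'].
  by rewrite Gj' in Gj; lia.
rewrite /raising (_ : leftmost _ = Some j).
  apply: (flips_replace _ _ neq Gj) => //.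
  rewrite -((exchange_startP F' t j s (ltn0Sn t)).2 _) //; split=> //.
    exact: lower_exchangeable_back ex fl.
  exact: lower_not_exchangeable_back sG les fl.
apply/leftmostP; rewrite eqB; split=> [|k /setU1P[-> //|/free_lowE[Gk _ _]]].
  exact: setU11.
(* A free [t] of [F] to the left of [j] would make row [r] of [F] increase from [t] to [t.+1]. *)
rewrite leqNgt; apply/negP => ltkj.
have := grid_row_anti r sG (ltnW ltkj); lia.
Qed.


Lemma raising_step F : semistandard F -> 0 < #|free_in_row F r t t| ->
  [/\ semistandard (raising r t F),
      #|free_in_row F r t t| = #|free_in_row (raising r t F) r t t|.+1,
      #|free_in_row (raising r t F) r t t.+1| = #|free_in_row F r t t.+1|.+1
    & lowering r t (raising r t F) = F].
Proof.
move=> /semistandardP[pos sG] /card_gt0P[j0 Aj0].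
have [j rj] : exists j, leftmost (free_in_row F r t t) = Some j.
  case: (@arg_minnP _ j0 (mem (free_in_row F r t t)) (fun k => k : nat) Aj0) => j Aj minj.
  by exists j; apply/leftmostP.
have -> : raising r t F = replace_entry F t t.+1 j by rewrite /raising rj.
move/leftmostP: rj => [Aj minj]; set F' := replace_entry F t t.+1 j.
set s := exchange_start F t t.+1 j.
have [les ex nex] := (exchange_startP F t j s (ltn0Sn t)).1 erefl.
have fj := (free_lowE F j).1 Aj; have [Gj nj _] := fj.
have neq : t != t.+1 by lia.
have fl : flips (grid F) (grid F') r t t.+1 s j.
  by apply: replace_flips => //; exact: raise_no_succ t0 fj.
have minj' k : k < j -> ~ free_low F t r k.
  move=> ltk frk; have ltka : k < alpha r by apply: (@grid_lt F); case: frk => ->.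
  by have := minj (Ordinal ltka) ((free_lowE F (Ordinal ltka)).2 frk); rewrite /=; lia.
have sG' := raise_semistandard t0 sG les fj minj' ex nex fl le_tr.
have low := raise_free_low t0 sG les fj minj' ex nex fl.
have high := raise_free_high t0 sG les fj ex fl.
have eqA : free_in_row F' r t t = free_in_row F r t t :\ j.
  apply/setP=> k; rewrite !in_setD1; apply/idP/andP => [/free_lowE/low[frk ne]|[ne /free_lowE frk]].
    by split; [apply: contra_not_neq ne => -> | apply/free_lowE].
  by apply/free_lowE/low; split=> // /ord_inj ekj; rewrite ekj eqxx in ne.
have eqB : free_in_row F' r t t.+1 = j |: free_in_row F r t t.+1.
  apply/setP=> k; apply/idP/setU1P => [/free_highE/high[frk|/ord_inj]|[->|frk]].
  - by right; apply/free_highE.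
  - by left.
  - by apply/free_highE/high; right.
  - by apply/free_highE/high; left; apply/free_highE.
split.
- apply/semistandardP; split=> // u.
  by rewrite -gridE (flips_gt0 _ _ _ _ fl) // gridE.
- by rewrite eqA (cardsD1 j (free_in_row F r t t)) Aj.
- rewrite eqB cardsU1; case: (boolP (j \in _)) => // /free_highE[Gj'].
  by rewrite Gj' in Gj; lia.
rewrite /lowering (_ : rightmost _ = Some j).
  apply: (flips_replace _ _ neq Gj) => //.
  rewrite -((exchange_startP F' t.+1 j s t0).2 _) //; split=> //.
    exact: raise_exchangeable_back ex fl.
  exact: raise_not_exchangeable_back sG les fl.
apply/rightmostP; rewrite eqB; split=> [|k /setU1P[-> //|/free_highE[Gk _ _]]].
  exact: setU11.
(* Dually, row [r] of [F] would increase from the [t] in column [j] to a [t.+1] further right. *)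
rewrite leqNgt; apply/negP => ltkj.
have := grid_row_anti r sG (ltnW ltkj); lia.
Qed.

End Steps.

(** * Iterated moves and the involution *)

Lemma iter_cancel_count (T : Type) (S : pred T) (f g : T -> T) (a b : T -> nat) :
  (forall x, S x -> 0 < a x ->
     [/\ S (f x), a x = (a (f x)).+1, b (f x) = (b x).+1 & g (f x) = x]) ->
  forall x m, S x -> m <= a x ->
    [/\ S (iter m f x), a x = a (iter m f x) + m, b (iter m f x) = b x + m
      & iter m g (iter m f x) = x].
Proof.
move=> step x m Sx; elim: m => [|m IHm] lem; first by rewrite !addn0.
have [Sm am bm gm] := IHm (ltnW lem).
have [|Sf af bf gf] := step _ Sm; first by lia.
(* The innermost [g] cancels the outermost [f]. *)
by rewrite [iter _ g _]iterSr iterS gf gm; split=> //; lia.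
Qed.

Theorem corollary2p8 (n : nat) (hn : 1 <= n) (alpha : 'I_n -> nat)
    (t : nat) (ht : 0 < t) (r : 'I_n) (hr : t.+1 <= r.+1) :
  (forall F : filling alpha, F \in SSF alpha -> Phi r t F \in SSF alpha) /\
  (forall F : filling alpha, F \in SSF alpha -> Phi r t (Phi r t F) = F) /\
  (forall F : filling alpha, F \in SSF alpha ->
     #|free_in_row (Phi r t F) r t t| = #|free_in_row F r t t.+1| /\
     #|free_in_row (Phi r t F) r t t.+1| = #|free_in_row F r t t|).
Proof.
suff main (F : filling alpha) : semistandard F ->
    [/\ semistandard (Phi r t F), Phi r t (Phi r t F) = F,
        #|free_in_row (Phi r t F) r t t| = #|free_in_row F r t t.+1|
      & #|free_in_row (Phi r t F) r t t.+1| = #|free_in_row F r t t|].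
  by split; [|split] => F /main[].
move=> sF.
(* With rows counted from 0, [hr] is convertible to [t <= r]. *)
have down := iter_cancel_count (S := @semistandard n alpha) (lowering_step ht hr).
have up := iter_cancel_count (S := @semistandard n alpha) (raising_step ht hr).
rewrite [Phi r t F]/Phi /=.
have [lt21|lt12|eqn] := ltngtP #|free_in_row F r t t| #|free_in_row F r t t.+1|.
- have := down F _ sF (leq_subr #|free_in_row F r t t| _).
  set L := iter _ _ F; case=> sL hi lo RL.
  (* Moving by the difference of the two counts swaps them, so the second [Phi] takes the opposite
     branch with the same number of moves. *)
  have [ehi elo] : #|free_in_row L r t t.+1| = #|free_in_row F r t t| /\
                   #|free_in_row L r t t| = #|free_in_row F r t t.+1| by lia.
  by split=> //; rewrite /Phi ehi elo ltn_eqF // ltnNge ltnW.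
- have := up F _ sF (leq_subr #|free_in_row F r t t.+1| _).
  set U := iter _ _ F; case=> sU lo hi LU.
  have [ehi elo] : #|free_in_row U r t t.+1| = #|free_in_row F r t t| /\
                   #|free_in_row U r t t| = #|free_in_row F r t t.+1| by lia.
  by split=> //; rewrite /Phi ehi elo gtn_eqF // lt12.
by rewrite -eqn; split=> //; rewrite /Phi -eqn eqxx.
Qed.
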